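(* On the set where $(u,v,w)\neq(0,0,0)$, the function $$\mathcal E=\frac{p}{u^2+v^2+w^2}$$ of the variables $x,y,z,t,u,v,w,p$ satisfies $\mathcal T\mathcal E=\mathcal X\mathcal E=\mathcal R_x\mathcal E=\mathcal R_y\mathcal E=\mathcal R_z\mathcal E=0$ (in particular it is scale-invariant). Moreover, for every solution of the three-dimensional incompressible Navier--Stokes equations of the form $$\vec u(x,y,z,t)=\frac{x}{t}\,\mathbf F\!\left(\frac yx,\frac zx\right),\qquad p(x,y,z,t)=\frac{x^2}{t^2}\,F\!\left(\frac yx,\frac zx\right),$$ with $\mathbf F=(F_1,F_2,F_3)$, the quantity $\mathcal E$ evaluated along the solution is conserved in time: wherever $\vec u\neq0$, $$\frac{p}{|\vec u|^2}=\frac{F}{F_1^2+F_2^2+F_3^2}\left(\frac yx,\frac zx\right),$$ which does not depend on $t$.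
   Context: The incompressible Navier--Stokes equations are $\partial_t\vec u+(\vec u\cdot\nabla)\vec u=\nu\Delta\vec u-\nabla p$, $\nabla\cdot\vec u=0$, $\vec u=(u,v,w)$, with $p$ standing for pressure divided by constant density. $\mathcal E$ is called the Euler, or cavitation, number. The infinitesimal operators admitted by the equations (time translations, scale changes, rotations) are $$\mathcal T=\frac{\partial}{\partial t},\qquad \mathcal X=x\frac{\partial}{\partial x}+y\frac{\partial}{\partial y}+z\frac{\partial}{\partial z}+2t\frac{\partial}{\partial t}-u\frac{\partial}{\partial u}-v\frac{\partial}{\partial v}-w\frac{\partial}{\partial w}-2p\frac{\partial}{\partial p},$$ $$\mathcal R_x=y\frac{\partial}{\partial z}-z\frac{\partial}{\partial y}+v\frac{\partial}{\partial w}-w\frac{\partial}{\partial v},\quad \mathcal R_y=z\frac{\partial}{\partial x}-x\frac{\partial}{\partial z}+w\frac{\partial}{\partial u}-u\frac{\partial}{\partial w},\quad \mathcal R_z=x\frac{\partial}{\partial y}-y\frac{\partial}{\partial x}+u\frac{\partial}{\partial v}-v\frac{\partial}{\partial u}.$$ The solutions of the displayed form are considered for $t\neq0$, $x\neq0$; they are a subset of Leray's self-similar solutions $\vec u=t^{-1/2}\mathbf G(\vec r/\sqrt t)$, $p=t^{-1}G(\vec r/\sqrt t)$. *)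

(* Defs.v *)
From mathcomp Require Import all_boot all_order all_algebra.
From mathcomp Require Import all_classical all_reals all_analysis.

Set Implicit Arguments.
Unset Strict Implicit.
Unset Printing Implicit Defensive.

Import Order.TTheory GRing.Theory Num.Theory.
Import numFieldNormedType.Exports.

Local Open Scope ring_scope.
Local Open Scope classical_set_scope.

Definition axis (R : realType) (n : nat) (i : 'I_n) : 'rV[R]_n := delta_mx 0 i.

(* ['D_v f a] has a value even where [f] has no derivative, so [partial] is
   only meaningful together with [has_partial]. *)
Definition partial (R : realType) (n : nat) (i : 'I_n) (f : 'rV[R]_n -> R)
  (a : 'rV[R]_n) : R := 'D_(axis R i) f a.

Definition has_partial (R : realType) (n : nat) (i : 'I_n) (f : 'rV[R]_n -> R)
  (a : 'rV[R]_n) : Prop := derivable f a (axis R i).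

Definition row_of_seq (R : realType) (n : nat) (s : seq R) : 'rV[R]_n :=
  \row_(k < n) s`_k.

(* The space of the variables (x, y, z, t, u, v, w, p). *)
Definition ix : 'I_8 := @Ordinal 8 0 isT.
Definition iy : 'I_8 := @Ordinal 8 1 isT.
Definition iz : 'I_8 := @Ordinal 8 2 isT.
Definition it : 'I_8 := @Ordinal 8 3 isT.
Definition iu : 'I_8 := @Ordinal 8 4 isT.
Definition iv : 'I_8 := @Ordinal 8 5 isT.
Definition iw : 'I_8 := @Ordinal 8 6 isT.
Definition ip : 'I_8 := @Ordinal 8 7 isT.

Definition phase_point (R : realType) (x y z t u v w p : R) : 'rV[R]_8 :=
  row_of_seq 8 [:: x; y; z; t; u; v; w; p].

Definition op_T (R : realType) (f : 'rV[R]_8 -> R) (a : 'rV[R]_8) : R :=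
  partial it f a.

Definition op_X (R : realType) (f : 'rV[R]_8 -> R) (a : 'rV[R]_8) : R :=
  a 0 ix * partial ix f a + a 0 iy * partial iy f a + a 0 iz * partial iz f a
  + 2 * a 0 it * partial it f a
  - a 0 iu * partial iu f a - a 0 iv * partial iv f a - a 0 iw * partial iw f a
  - 2 * a 0 ip * partial ip f a.

Definition op_Rx (R : realType) (f : 'rV[R]_8 -> R) (a : 'rV[R]_8) : R :=
  a 0 iy * partial iz f a - a 0 iz * partial iy f a
  + a 0 iv * partial iw f a - a 0 iw * partial iv f a.

Definition op_Ry (R : realType) (f : 'rV[R]_8 -> R) (a : 'rV[R]_8) : R :=
  a 0 iz * partial ix f a - a 0 ix * partial iz f a
  + a 0 iw * partial iu f a - a 0 iu * partial iw f a.

Definition op_Rz (R : realType) (f : 'rV[R]_8 -> R) (a : 'rV[R]_8) : R :=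
  a 0 ix * partial iy f a - a 0 iy * partial ix f a
  + a 0 iu * partial iv f a - a 0 iv * partial iu f a.

(* The one-parameter group generated by [op_X], with parameter [ln l], l > 0. *)
Definition rescale (R : realType) (l : R) (a : 'rV[R]_8) : 'rV[R]_8 :=
  phase_point (l * a 0 ix) (l * a 0 iy) (l * a 0 iz) (l ^+ 2 * a 0 it)
    (l^-1 * a 0 iu) (l^-1 * a 0 iv) (l^-1 * a 0 iw) (l ^- 2 * a 0 ip).

Definition euler_number (R : realType) (a : 'rV[R]_8) : R :=
  a 0 ip / (a 0 iu ^+ 2 + a 0 iv ^+ 2 + a 0 iw ^+ 2).

(* Space-time points are (x, y, z, t) : 'rV_4, velocities (u, v, w) : 'rV_3. *)
Definition spacetime (R : realType) (x y z t : R) : 'rV[R]_4 :=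
  row_of_seq 4 [:: x; y; z; t].

Definition space_axis (j : 'I_3) : 'I_4 := widen_ord (leqnSn 3) j.

Definition time_axis : 'I_4 := ord_max.

(* Classical solutions on [D]: the derivatives in the equations exist at every
   point of [D]; no continuity of the second derivatives is required. *)
Definition NavierStokes_solution (R : realType) (nu : R) (D : set 'rV[R]_4)
    (u : 'rV[R]_4 -> 'rV[R]_3) (p : 'rV[R]_4 -> R) : Prop :=
  forall a, D a ->
    [/\ (forall i : 'I_3,
           has_partial time_axis (fun b => u b 0 i) a /\
           forall j : 'I_3,
             has_partial (space_axis j) (fun b => u b 0 i) a /\
             has_partial (space_axis j)
               (partial (space_axis j) (fun b => u b 0 i)) a),
        (forall i : 'I_3, has_partial (space_axis i) p a),
        (forall i : 'I_3,
           partial time_axis (fun b => u b 0 i) a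
           + \sum_(j < 3) u a 0 j * partial (space_axis j) (fun b => u b 0 i) a
           = nu * \sum_(j < 3) partial (space_axis j)
                    (partial (space_axis j) (fun b => u b 0 i)) a
             - partial (space_axis i) p a)
      & \sum_(j < 3) partial (space_axis j) (fun b => u b 0 j) a = 0].

Definition euler_along (R : realType) (u : 'rV[R]_4 -> 'rV[R]_3)
    (p : 'rV[R]_4 -> R) (x y z t : R) : R :=
  let a := spacetime x y z t in
  euler_number
    (phase_point x y z t (u a 0 (inord 0)) (u a 0 (inord 1)) (u a 0 (inord 2))
       (p a)).

(* Main.v *)
Require Import Defs.
From mathcomp Require Import all_boot all_order all_algebra.
From mathcomp Require Import all_classical all_reals all_analysis.
From mathcomp Require Import ring.

Set Implicit Arguments.
Unset Strict Implicit.
Unset Printing Implicit Defensive.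

Import Order.TTheory GRing.Theory Num.Theory.
Import numFieldNormedType.Exports.

Local Open Scope ring_scope.
Local Open Scope classical_set_scope.

(** The number E = p / q, with q the squared speed, does not involve
    x, y, z, t, so only the u, v, w, p parts of the operators act on it.
    Scaling multiplies p and q by the same factor, the inverse square of the
    ratio, and a rotation fixes p and q; hence E is invariant under all the
    flows.  Infinitesimally, the quotient rule [is_derive_euler_number] gives
    all the partial derivatives of E, and what remains is that the radial
    field has numerator - 2 p q + 2 p q = 0 while the rotational fields bring
    in antisymmetric terms such as v w - w v.

    Along a solution of the self-similar form, t enters only through the
    amplitude x / t of the velocity, whose square is the amplitude of the
    pressure.  The two amplitudes cancel in E, which is thus a function of
    y / x and z / x alone ([euler_along_self_similar]). *)

Definition speed_sq (R : realType) (a : 'rV[R]_8) : R :=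
  a 0 iu ^+ 2 + a 0 iv ^+ 2 + a 0 iw ^+ 2.

(** A sum of real squares vanishes only if each square does. *)
Lemma speed_sq_neq0 (R : realType) (a : 'rV[R]_8) :
  (a 0 iu, a 0 iv, a 0 iw) <> (0, 0, 0) -> speed_sq a != 0.
Proof.
apply: contra_not_neq => /eqP; rewrite /speed_sq.
rewrite !paddr_eq0 ?addr_ge0 ?sqr_ge0// !sqrf_eq0.
by case/andP => /andP[/eqP -> /eqP ->] /eqP ->.
Qed.

(** A coordinate is a component of the identity, whose derivative along [v] is
    [v]. *)
Lemma is_derive_coord (R : realType) n (a v : 'rV[R]_n) (k : 'I_n) :
  is_derive a v (fun b => b 0 k) (v 0 k).
Proof.
have dv : derivable (fun b : 'rV[R]_n => b) a v by exact: derivable_id.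
apply: DeriveDef; first by move/derivable_mxP : dv; apply.
by have /(congr1 (fun M : 'rV[R]_n => M 0 k)) := derive_mx dv;
  rewrite derive_id mxE.
Qed.

Lemma is_derive_speed_sq (R : realType) (a v : 'rV[R]_8) :
  is_derive a v (@speed_sq R)
    (2 * (a 0 iu * v 0 iu + a 0 iv * v 0 iv + a 0 iw * v 0 iw)).
Proof.
have dk := is_derive_coord a v.
have sqE : @speed_sq R = (fun b => b 0 iu) ^+ 2 + (fun b => b 0 iv) ^+ 2
                         + (fun b => b 0 iw) ^+ 2 by exact/funext.
rewrite sqE; apply: is_derive_eq.
rewrite /GRing.scale /=; ring.
Qed.

(** Quotient rule, along an arbitrary direction so that all the partial
    derivatives come from one computation. *)
Lemma is_derive_euler_number (R : realType) (a v : 'rV[R]_8) :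
  speed_sq a != 0 ->
  is_derive a v (@euler_number R)
    (v 0 ip / speed_sq a
     - 2 * a 0 ip * (a 0 iu * v 0 iu + a 0 iv * v 0 iv + a 0 iw * v 0 iw)
       / speed_sq a ^+ 2).
Proof.
move=> q0; have [dq dqE] := is_derive_speed_sq a v.
have dV : is_derive a v (fun b => (speed_sq b)^-1)
    (- speed_sq a ^- 2 *:
      (2 * (a 0 iu * v 0 iu + a 0 iv * v 0 iv + a 0 iw * v 0 iw))).
  by apply: DeriveDef; [exact: derivableV|rewrite deriveV// dqE].
apply: is_derive_eq; first exact: (is_deriveM (is_derive_coord a v ip) dV).
rewrite /GRing.scale /=; field.
by [].
Qed.

Lemma differentiable_euler_number (R : realType) (a : 'rV[R]_8) :
  speed_sq a != 0 -> differentiable (@euler_number R) a.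
Proof.
move=> q0; have dk k : differentiable (fun b : 'rV[R]_8 => b 0 k) a.
  exact: differentiable_coord.
have dX k : differentiable (fun b : 'rV[R]_8 => b 0 k ^+ 2) a.
  exact: (differentiableX 1 (dk k)).
apply: differentiableM => //; apply: differentiableV => //.
by do 2![apply: differentiableD => //].
Qed.

Lemma partial_euler_number (R : realType) (a : 'rV[R]_8) (i : 'I_8) :
  speed_sq a != 0 ->
  partial i (@euler_number R) a =
    (ip == i)%:R / speed_sq a
    - 2 * a 0 ip * (a 0 iu * (iu == i)%:R + a 0 iv * (iv == i)%:R
                    + a 0 iw * (iw == i)%:R) / speed_sq a ^+ 2.
Proof.
move=> q0; rewrite /partial /axis.
by have [_ ->] := is_derive_euler_number (delta_mx 0 i) q0; rewrite !mxE.
Qed.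

Lemma euler_number_phase_point (R : realType) (x y z t u v w p : R) :
  euler_number (phase_point x y z t u v w p)
  = p / (u ^+ 2 + v ^+ 2 + w ^+ 2).
Proof. by rewrite /euler_number !mxE. Qed.

(** Pressure and squared speed both carry the factor [l ^- 2]. *)
Lemma euler_number_rescale (R : realType) (l : R) (a : 'rV[R]_8) :
  l != 0 -> euler_number (rescale l a) = euler_number a.
Proof.
move=> l0; rewrite /rescale euler_number_phase_point /euler_number.
by rewrite !exprMn -!mulrDr exprVn -mulf_div divff ?mul1r ?invr_eq0 ?expf_neq0.
Qed.

(** The factor [(x / t) ^+ 2] common to pressure and squared speed cancels.
    Where the profile velocity vanishes both sides are 0, as divisions by 0. *)
Lemma euler_along_self_similar (R : realType) (u : 'rV[R]_4 -> 'rV[R]_3)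
    (p : 'rV[R]_4 -> R) (x y z t f1 f2 f3 f : R) :
  x != 0 -> t != 0 ->
  u (spacetime x y z t) = (x / t) *: row_of_seq 3 [:: f1; f2; f3] ->
  p (spacetime x y z t) = x ^+ 2 / t ^+ 2 * f ->
  euler_along u p x y z t = f / (f1 ^+ 2 + f2 ^+ 2 + f3 ^+ 2).
Proof.
move=> x0 t0 uE pE; rewrite /euler_along euler_number_phase_point uE pE.
rewrite !mxE !inordK//= !exprMn -!mulrDr exprVn -mulf_div divff ?mul1r//.
by rewrite mulf_neq0 ?invr_eq0 ?expf_neq0.
Qed.

Theorem mainTheorem5 (R : realType) :
  (forall a : 'rV[R]_8,
     (a 0 iu, a 0 iv, a 0 iw) <> (0, 0, 0) ->
     [/\ differentiable (@euler_number R) a,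
         [/\ op_T (@euler_number R) a = 0,
             op_X (@euler_number R) a = 0,
             op_Rx (@euler_number R) a = 0,
             op_Ry (@euler_number R) a = 0
           & op_Rz (@euler_number R) a = 0]
       & forall l : R, 0 < l -> euler_number (rescale l a) = euler_number a])
  /\
  (forall (nu : R) (D : set 'rV[R]_4)
          (u : 'rV[R]_4 -> 'rV[R]_3) (p : 'rV[R]_4 -> R)
          (F1 F2 F3 F : R -> R -> R),
     open D ->
     (forall x y z t : R, D (spacetime x y z t) -> x != 0 /\ t != 0) ->
     NavierStokes_solution nu D u p ->
     (forall x y z t : R, D (spacetime x y z t) ->
        u (spacetime x y z t) =
          (x / t) *: row_of_seq 3 [:: F1 (y / x) (z / x); F2 (y / x) (z / x);
                                      F3 (y / x) (z / x)] /\
        p (spacetime x y z t) = x ^+ 2 / t ^+ 2 * F (y / x) (z / x)) ->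
     forall x y z t : R, D (spacetime x y z t) ->
       u (spacetime x y z t) <> 0 ->
       euler_along u p x y z t =
         F (y / x) (z / x) /
         (F1 (y / x) (z / x) ^+ 2 + F2 (y / x) (z / x) ^+ 2
          + F3 (y / x) (z / x) ^+ 2)
       /\
       forall t' : R, D (spacetime x y z t') ->
         u (spacetime x y z t') <> 0 /\
         euler_along u p x y z t' = euler_along u p x y z t).
Proof.
split=> [a /speed_sq_neq0 q0 | nu D u p F1 F2 F3 F _ D0 _ form x y z t Dt ut].
  split; last by move=> l l_gt0; rewrite euler_number_rescale ?gt_eqF.
    exact: differentiable_euler_number.
  (* The Kronecker deltas are evaluated first: each operator becomes a rational
     expression in the coordinates with denominator the squared speed. *)
  rewrite /op_T /op_X /op_Rx /op_Ry /op_Rz !partial_euler_number//.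
  rewrite /= !(mulr0, mulr1, addr0, add0r, mul0r, subr0, sub0r).
  by rewrite /speed_sq in q0 *; split=> //; field.
have [x0 t0] := D0 _ _ _ _ Dt; have [uE pE] := form _ _ _ _ Dt.
have along := euler_along_self_similar x0 t0 uE pE.
split=> // t' Dt'.
have [_ t'0] := D0 _ _ _ _ Dt'; have [uE' pE'] := form _ _ _ _ Dt'.
split; last by rewrite along (euler_along_self_similar x0 t'0 uE' pE').
(* The profile velocity is the same at both times and the amplitudes are
   nonzero, so the velocity cannot vanish at one time only. *)
move: ut; rewrite uE uE'; apply: contra_not => /eqP.
rewrite scaler_eq0 mulf_eq0 invr_eq0 (negPf x0) (negPf t'0) => /eqP ->.
by rewrite scaler0.
Qed.
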